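(* Let $\mathbb{k}$ be a field. The inequality $$\operatorname{reg}(B(\Delta))\geq \operatorname{reg}(\Delta)+1$$ holds for any simplicial complex $\Delta$.
   Context: A simplicial complex $\Delta$ on a finite set $V$ is a family of subsets of $V$, closed under taking subsets, with $\{v\}\in\Delta$ for all $v\in V$. Its maximal faces are called facets; $\mathcal{F}_\Delta$ is the set of facets. The bipartite graph $B(\Delta)$ has vertex set $V\cup\mathcal{F}_\Delta$ (disjoint union), with $s\in V$ adjacent to $F\in\mathcal{F}_\Delta$ if and only if $s\notin F$. Fix a field $\mathbb{k}$. For a simplicial complex $\Delta$ on $V$, let $R=\mathbb{k}[V]$ and let $I_\Delta$ be its Stanley-Reisner ideal (generated by the squarefree monomials corresponding to the minimal non-faces of $\Delta$). Then $\operatorname{reg}(\Delta):=\operatorname{reg}(R/I_\Delta)=\max\{j-i:\beta_{i,j}(R/I_\Delta)\neq 0\}$, where $\beta_{i,j}$ are the graded Betti numbers. For a finite simple graph $G$, $\operatorname{reg}(G):=\operatorname{reg}(\operatorname{Ind}(G))$, where $\operatorname{Ind}(G)$ is the simplicial complex of independent sets of $G$.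
   Formalization: The formal theorem assumes that V itself is not a face of Δ: for the full simplex, I_Δ = 0 and B(Δ) has no edges, so both regularities are 0 and the stated inequality fails. *)

(* Defs.v *)
From HB Require Import structures.
From mathcomp Require Import all_boot all_order all_algebra.
From mathcomp Require Import mpoly.

Set Implicit Arguments.
Unset Strict Implicit.
Unset Printing Implicit Defensive.

Import Order.TTheory GRing.Theory Num.Theory.
Local Open Scope ring_scope.

Record complex (V : finType) := Complex {
  faces :> {set {set V}};
  faces_sub : forall F G : {set V}, F \in faces -> G \subset F -> G \in faces;
  faces_vertex : forall v : V, [set v] \in faces
}.

Definition facets (V : finType) (D : complex V) : {set {set V}} :=
  [set F | maxset [pred A : {set V} | A \in faces D] F].

Definition min_nonfaces (V : finType) (D : complex V) : {set {set V}} :=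
  [set N | minset [pred A : {set V} | A \notin faces D] N].

Record sgraph (T : finType) := SGraph {
  adj :> rel T;
  adj_sym : ssrbool.symmetric adj;
  adj_irr : irreflexive adj
}.

Definition independent (T : finType) (G : sgraph T) (A : {set T}) : bool :=
  [forall x in A, forall y in A, ~~ adj G x y].

Section Ind.
Variables (T : finType) (G : sgraph T).

Definition ind_faces : {set {set T}} := [set A | independent G A].

Fact ind_faces_sub (A B : {set T}) :
  A \in ind_faces -> B \subset A -> B \in ind_faces.
Proof.
rewrite !inE => /forall_inP hA /subsetP sBA.
apply/forall_inP => x /sBA /hA /forall_inP hx.
by apply/forall_inP => y /sBA /hx.
Qed.

Fact ind_faces_vertex (x : T) : [set x] \in ind_faces.
Proof.
rewrite inE; apply/forall_inP => y /set1P ->.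
by apply/forall_inP => z /set1P ->; rewrite adj_irr.
Qed.

Definition Ind : complex T := Complex ind_faces_sub ind_faces_vertex.

End Ind.

Section BipartiteGraph.
Variables (V : finType) (D : complex V).

Definition bip_vertex : finType := (V + {F : {set V} | F \in facets D})%type.

Definition bip_adj (x y : bip_vertex) : bool :=
  match x, y with
  | inl s, inr F | inr F, inl s => s \notin val F
  | _, _ => false
  end.

Fact bip_adj_sym : ssrbool.symmetric bip_adj.
Proof. by case=> [s|F] [t|H]. Qed.

Fact bip_adj_irr : irreflexive bip_adj.
Proof. by case. Qed.

Definition bip : sgraph bip_vertex := SGraph bip_adj_sym bip_adj_irr.

End BipartiteGraph.

Section StanleyReisner.
Variables (k : fieldType) (V : finType) (D : complex V).

(* k[V] is {mpoly k[#|V|]}, the variable of v : V being 'X_(enum_rank v). *)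
Definition sqfree_monomial (N : {set V}) : {mpoly k[#|V|]} :=
  \prod_(v in N) 'X_(enum_rank v).

Definition SR_ideal (f : {mpoly k[#|V|]}) : Prop :=
  exists c : {set V} -> {mpoly k[#|V|]},
    f = \sum_(N in min_nonfaces D) c N * sqfree_monomial N.

End StanleyReisner.

(* A graded free resolution ... -> F_1 -> F_0 -> R/I -> 0, R = k[x_1..x_n].
   F_i is free on basis vectors e_p, p < rk i, with e_p of degree gdeg p, that
   is F_i = \bigoplus_p R(- gdeg p).  Elements of F_i are row vectors and
   F_(i+1) -> F_i is v |-> v *m diff i; F_0 -> R/I is v |-> v *m aug mod I.
   Ranks are not required to vanish eventually.  The homogeneity fields say
   that the maps have degree 0: each coordinate is a sum of monomials of the
   right degree, and hence 0 if that degree would be negative. *)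
Record graded_free_resolution (k : fieldType) (n : nat)
    (I : {mpoly k[n]} -> Prop) := GradedFreeResolution {
  rk : nat -> nat;
  gdeg : forall i : nat, 'I_(rk i) -> nat;
  diff : forall i : nat, 'M[{mpoly k[n]}]_(rk i.+1, rk i);
  aug : 'cV[{mpoly k[n]}]_(rk 0);
  diff_homog : forall (i : nat) (p : 'I_(rk i.+1)) (q : 'I_(rk i)),
    {in msupp (diff i p q), forall m, (mdeg m + gdeg q = gdeg p)%N};
  aug_homog : forall p : 'I_(rk 0),
    {in msupp (aug p 0), forall m, mdeg m = gdeg p};
  aug_surj : forall f : {mpoly k[n]},
    exists v : 'rV[{mpoly k[n]}]_(rk 0), I (f - (v *m aug) 0 0);
  aug_exact : forall v : 'rV[{mpoly k[n]}]_(rk 0),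
    I ((v *m aug) 0 0) <->
    exists w : 'rV[{mpoly k[n]}]_(rk 1), v = w *m diff 0;
  diff_exact : forall (i : nat) (v : 'rV[{mpoly k[n]}]_(rk i.+1)),
    v *m diff i = 0 <->
    exists w : 'rV[{mpoly k[n]}]_(rk i.+2), v = w *m diff i.+1
}.

(* F_(i+1) is mapped into (x_1, ..., x_n) F_i for all i. *)
Definition minimal_resolution (k : fieldType) (n : nat)
    (I : {mpoly k[n]} -> Prop) (F : graded_free_resolution I) : Prop :=
  forall (i : nat) (p : 'I_(rk F i.+1)) (q : 'I_(rk F i)),
    (diff F i p q)@_0%MM = 0.

(* For minimal F, the graded Betti number beta_(i,j) of R/I: the multiplicity
   of R(-j) in F_i. *)
Definition betti (k : fieldType) (n : nat) (I : {mpoly k[n]} -> Prop)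
    (F : graded_free_resolution I) (i j : nat) : nat :=
  #|[pred p : 'I_(rk F i) | gdeg p == j]|.

(* reg(R/I) = r.  Minimal graded free resolutions of R/I are unique up to
   isomorphism, so at most one r qualifies; none does if R/I = 0. *)
Definition is_reg_quotient (k : fieldType) (n : nat)
    (I : {mpoly k[n]} -> Prop) (r : int) : Prop :=
  exists F : graded_free_resolution I,
    [/\ minimal_resolution F,
        exists i j : nat, betti F i j != 0%N /\ r = j%:Z - i%:Z &
        forall i j : nat, betti F i j != 0%N -> j%:Z - i%:Z <= r].

Definition is_reg (k : fieldType) (V : finType) (D : complex V) (r : int) :
  Prop := is_reg_quotient (@SR_ideal k V D) r.

Definition is_reg_graph (k : fieldType) (T : finType) (G : sgraph T)
  (r : int) : Prop := is_reg k (Ind G) r.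

(* Main.v *)
(** Tor_i(R/I_Delta, k) can be computed from a minimal resolution, where it is
    counted by the Betti numbers, or from the Koszul complex of R/I_Delta; the two
    agree by dimension shifting along the resolution.  The Koszul complex splits
    into multidegree strands.  In a multidegree with an exponent at least 2 the
    strand is a cone, and in a squarefree multidegree S it is the reduced cochain
    complex of Delta[S] (Hochster's formula).  So reg(Delta) is the largest s such
    that some Delta[S] has a nonzero class on faces with s vertices.  Restricted to
    S and all facets, Ind(B(Delta)) is the union of the full simplex on S and of
    the acyclic complex of the faces whose part in S belongs to Delta; the two meet
    in Delta[S], so for S nonempty the connecting map turns that class into one on
    faces with s + 1 vertices.  If S is empty, then s = 0, and an edge of B(Delta)
    gives the class. *)

Require Import Defs.
From mathcomp Require Import all_boot all_order all_algebra.
From mathcomp Require Import mpoly.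
From Stdlib Require Import Classical IndefiniteDescription.

Set Implicit Arguments.
Unset Strict Implicit.
Unset Printing Implicit Defensive.

Import GRing.Theory.
Local Open Scope ring_scope.

(** * Simplicial coboundaries *)

(* [e a A] encodes the sign [(-1) ^+ e a A]; the condition is what makes the
   coboundary below square to zero. *)
Definition sign_system (W : finType) (U : {set W}) (e : W -> {set W} -> bool) :=
  forall (A : {set W}) (a b : W), A \subset U -> a \in A -> b \in A -> a != b ->
    e a A (+) e b (A :\ a) = ~~ (e b A (+) e a (A :\ b)).

Definition rank_sign (W : finType) (a : W) (A : {set W}) : bool :=
  odd #|[set x in A | (enum_rank x < enum_rank a)%N]|.

Lemma rank_sign_system (W : finType) (U : {set W}) : sign_system U (@rank_sign W).
Proof.
move=> A a b _ aA bA ab; rewrite /rank_sign.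
have cnt (x y : W) : y \in A -> #|[set z in A | (enum_rank z < enum_rank x)%N]| =
    ((enum_rank y < enum_rank x)%N +
     #|[set z in A :\ y | (enum_rank z < enum_rank x)%N]|)%N.
  move=> yA; rewrite (cardsD1 y) !inE yA /=; congr (_ + #|pred_of_set _|)%N.
  by apply/setP => z; rewrite !inE andbA.
rewrite (cnt a b bA) (cnt b a aA) !oddD !oddb.
have -> : (enum_rank b < enum_rank a)%N = ~~ (enum_rank a < enum_rank b)%N.
  by rewrite -leqNgt ltn_neqAle (inj_eq (@ord_inj _)) (inj_eq enum_rank_inj) eq_sym ab.
by case: (_ < _)%N; case: (odd _); case: (odd _).
Qed.

Section Coboundary.
Variables (k : pzRingType) (W : finType).
Implicit Types (e : W -> {set W} -> bool) (f g : {set W} -> k) (A B U : {set W}).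

Definition cobound e f A : k :=
  \sum_(a in A) (-1) ^+ e a A * f (A :\ a).

Lemma eq_cobound e f g A :
  (forall a, a \in A -> f (A :\ a) = g (A :\ a)) -> cobound e f A = cobound e g A.
Proof. by move=> fg; apply: eq_bigr => a aA; rewrite fg. Qed.

Lemma eq_cobound_sign e e' f A :
  (forall a, a \in A -> e a A = e' a A) -> cobound e f A = cobound e' f A.
Proof. by move=> ee; apply: eq_bigr => a aA; rewrite ee. Qed.

Lemma cobound_eq0 e f A : (forall a, a \in A -> f (A :\ a) = 0) -> cobound e f A = 0.
Proof. by move=> f0; apply: big1 => a aA; rewrite f0 ?mulr0. Qed.

Lemma coboundB e f g A :
  cobound e (fun B => f B - g B) A = cobound e f A - cobound e g A.
Proof. by rewrite -sumrB; apply: eq_bigr => a _; rewrite mulrBr. Qed.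

Lemma coboundD e f g A :
  cobound e (fun B => f B + g B) A = cobound e f A + cobound e g A.
Proof. by rewrite -big_split; apply: eq_bigr => a _; rewrite mulrDr. Qed.

Lemma cobound_neq0 e f A : cobound e f A != 0 -> exists2 a, a \in A & f (A :\ a) != 0.
Proof.
move=> nz; apply/exists_inP; apply: contraNT nz.
rewrite negb_exists_in => /forall_inP f0; apply/eqP/cobound_eq0 => a /f0.
by rewrite negbK => /eqP.
Qed.

(** Comparing ranks matches each ordered pair with its reverse, so terms cancel without a division
    by 2; this covers characteristic 2. *)
Lemma sum_skew (g : W -> W -> k) A :
  (forall a b, a \in A -> b \in A -> a != b -> g a b = - g b a) ->
  \sum_(a in A) \sum_(b in A :\ a) g a b = 0.
Proof.
move=> skew.
pose r (a b : W) := (enum_rank a < enum_rank b)%N.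
have split a : \sum_(b in A :\ a) g a b =
    \sum_(b in A | r a b) g a b + \sum_(b in A | r b a) g a b.
  rewrite (bigID (r a)) /=; congr (_ + _); apply: eq_bigl => b;
    rewrite !inE /r -(inj_eq enum_rank_inj) -(inj_eq (@ord_inj _));
    by case: ltngtP; rewrite ?andbT ?andbF.
rewrite (eq_bigr _ (fun a _ => split a)) big_split /=.
rewrite (exchange_big_dep (mem A)) /=; last by move=> a b _ /andP[].
rewrite -big_split big1 //= => a aA.
rewrite aA /=.
have -> : \sum_(b in A | r b a) g b a = \sum_(b in A | r b a) - g a b.
  apply: eq_bigr => b /andP[bA rba]; apply: skew => //.
  by apply: contraTneq rba => ->; rewrite /r ltnn.
by rewrite sumrN addNr.
Qed.

Lemma cobound_cobound U e f A :
  sign_system U e -> A \subset U -> cobound e (cobound e f) A = 0.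
Proof.
move=> se AU; rewrite /cobound.
under eq_bigr => a _ do rewrite mulr_sumr.
apply: sum_skew => a b aA bA ab.
have -> : A :\ b :\ a = A :\ a :\ b by apply/setP => x; rewrite !inE andbCA.
rewrite !mulrA -!signr_addb (se A a b) //.
by rewrite signrN mulNr.
Qed.

Definition contract e (v : W) f A : k :=
  if v \in A then 0 else (-1) ^+ e v (v |: A) * f (v |: A).

(** If [v] lies in [A], only the removal of [v] contributes and gives back [f A]. Otherwise removing
    [v] from [v |: A] gives [f A], and the other terms cancel in pairs by the sign condition. *)
Lemma contract_homotopy U e v f A :
  sign_system U e -> v \in U -> A \subset U ->
  cobound e (contract e v f) A + contract e v (cobound e f) A = f A.
Proof.
move=> se vU AU; rewrite {2}/contract; case: ifPn => vA.
  rewrite addr0 /cobound (big_setD1 v) //= big1 ?addr0.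
    by rewrite /contract setD11 setD1K // mulrA -signr_addb addbb mul1r.
  by move=> a /setD1P[av aA]; rewrite /contract !inE eq_sym av vA mulr0.
rewrite /cobound [X in _ + _ * X](big_setU1 _ vA) /= setU1K //.
rewrite mulrDr mulrA -signr_addb addbb mul1r addrCA mulr_sumr -big_split big1 ?addr0 //=.
move=> a aA; have av : v != a by apply: contraNneq vA => ->.
have -> : (v |: A) :\ a = v |: (A :\ a).
  by apply/setP => x; rewrite !inE; case: eqVneq => //= ->; rewrite eq_sym (negbTE av).
rewrite /contract !inE (negbTE av) (negbTE vA) /= !mulrA -!signr_addb.
have := se (v |: A) v a; rewrite setU1K // !inE eqxx aA orbT subUset sub1set vU AU.
move=> /(_ isT isT isT av).
have -> : (v |: A) :\ a = v |: (A :\ a).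
  by apply/setP => x; rewrite !inE; case: (x =P a) => //= ->; rewrite eq_sym (negbTE av).
case: (e v (v |: A)); case: (e a A); case: (e a (v |: A)); case: (e v (v |: A :\ a)) => //= _;
  by rewrite ?expr0 ?expr1 ?mul1r ?mulN1r ?addrN ?addNr.
Qed.

(** The second term of the homotopy formula involves [cobound e f] only at [v |: A], where the cone
    condition makes it vanish. *)
Lemma cone_acyclic U e v (X : pred {set W}) f :
  sign_system U e -> v \in U ->
  (forall A, A \subset U -> X A -> X (v |: A)) ->
  (forall A, A \subset U -> X A -> cobound e f A = 0) ->
  forall A, A \subset U -> X A -> f A = cobound e (contract e v f) A.
Proof.
move=> se vU cone f0 A AU XA.
rewrite -[LHS](contract_homotopy f se vU AU) {2}/contract f0 ?mulr0 ?if_same ?addr0 //.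
  by rewrite subUset sub1set vU.
exact: cone.
Qed.

(** Reduced cohomology of [X] restricted to [U], the equations being imposed only at faces. Counting
    vertices, [s] stands for cohomological degree [s - 1]. *)
Definition nonzero_class e (X : pred {set W}) U (s : nat) : Prop :=
  exists c : {set W} -> k,
  [/\ forall A, A \subset U -> c A != 0 -> #|A| = s,
      forall A, A \subset U -> X A -> cobound e c A = 0 &
      ~ exists h, forall A, A \subset U -> X A -> c A = cobound e h A].

Lemma eq_nonzero_class e e' X U s :
  (forall a A, A \subset U -> a \in A -> e a A = e' a A) ->
  nonzero_class e X U s -> nonzero_class e' X U s.
Proof.
move=> ee [c [cs c0 cN]]; exists c; split=> // [A AU XA | [h ch]].
  by rewrite -(c0 A AU XA); apply: eq_cobound_sign => a aA; rewrite ee.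
apply: cN; exists h => A AU XA; rewrite ch //.
by apply: eq_cobound_sign => a aA; rewrite ee.
Qed.

End Coboundary.

(** * The suspension in the independence complex *)

Section Suspension.
Variables (k : fieldType) (V : finType) (D : complex V).
Local Notation W := (bip_vertex D).
Local Notation F := {F : {set V} | F \in facets D}.
Implicit Types (A S : {set V}) (X Y : {set W}).

Definition left_part X : {set V} := inl @^-1: X.

Lemma facet_above A : A \in faces D -> exists phi : F, A \subset val phi.
Proof.
move=> AD; have [B maxB AB] := maxset_exists (P := [pred A | A \in faces D]) AD.
have BF : B \in facets D by rewrite inE.
by exists (exist _ B BF).
Qed.

Lemma facet_face (phi : F) : val phi \in faces D.
Proof. by have := valP phi; rewrite inE => /maxsetp. Qed.

Lemma imset_inl_disjoint (phi : F) A : (inr phi : W) \notin inl @: A.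
Proof. by apply/imsetP => -[]. Qed.

Lemma mem_imset_inl (v : V) A : ((inl v : W) \in inl @: A) = (v \in A).
Proof. by apply: mem_imset => x y []. Qed.

Lemma imset_inlD1 (v : V) A : (inl @: A) :\ (inl v : W) = inl @: (A :\ v).
Proof.
apply/setP=> -[w|phi]; rewrite !inE ?mem_imset_inl ?inE //.
by rewrite !(negbTE (imset_inl_disjoint _ _)).
Qed.

Lemma left_part_imset A : left_part (inl @: A) = A.
Proof. by apply/setP => v; rewrite inE mem_imset_inl. Qed.

Lemma left_partD1l (v : V) X : left_part (X :\ inl v) = left_part X :\ v.
Proof. by apply/setP => w; rewrite !inE. Qed.

Lemma left_partD1r (phi : F) X : left_part (X :\ inr phi) = left_part X.
Proof. by apply/setP => w; rewrite !inE. Qed.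

Lemma left_partU1r (phi : F) X : left_part (inr phi |: X) = left_part X.
Proof. by apply/setP => w; rewrite !inE. Qed.

Lemma bip_faceP X :
  reflect (forall v phi, inl v \in X -> inr phi \in X -> v \in val phi)
          (X \in faces (Ind (bip D))).
Proof.
rewrite inE; apply: (iffP forall_inP) => [indX v phi vX phiX | indX].
  by have /forall_inP/(_ _ phiX)/= := indX _ vX; rewrite negbK.
case=> [v|phi] vX; apply/forall_inP => -[w|psi] wX //=; rewrite negbK;
  exact: indX.
Qed.

(** A facet in an independent set contains its whole left part. Hence independent sets lying over a
    nonface of [D] contain no facet. *)
Lemma left_face X (phi : F) :
  X \in faces (Ind (bip D)) -> inr phi \in X -> left_part X \in faces D.
Proof.
move=> /bip_faceP indX phiX; apply: faces_sub (facet_face phi) _.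
by apply/subsetP => v; rewrite inE => vX; apply: indX vX phiX.
Qed.

Lemma cobound_imset_inl (e : W -> {set W} -> bool) (f : {set W} -> k) A :
  cobound e f (inl @: A) =
  cobound (fun v B => e (inl v) (inl @: B)) (fun B => f (inl @: B)) A.
Proof.
rewrite /cobound big_imset /=; last by move=> x y _ _ [].
by apply: eq_bigr => v _; rewrite imset_inlD1.
Qed.

Definition bip_support S : {set W} :=
  [set x | match x with inl v => v \in S | inr _ => true end].

Lemma imset_inl_support A S : (inl @: A \subset bip_support S) = (A \subset S).
Proof.
apply/subsetP/subsetP => [sub v vA | sub x /imsetP[v vA ->]].
  by have := sub (inl v); rewrite mem_imset_inl inE => ->.
by rewrite inE sub.
Qed.

Section Sign.
Variables (e : W -> {set W} -> bool) (S : {set V}).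
Hypothesis se : sign_system (bip_support S) e.
Let U := bip_support S.
Let eV := fun v A => e (inl v) (inl @: A).

Lemma sign_system_inl : sign_system S eV.
Proof.
move=> A a b AS aA bA ab; rewrite /eV -!imset_inlD1.
by apply: se; rewrite ?imset_inl_support ?mem_imset_inl.
Qed.

Definition over_face X := (X \in faces (Ind (bip D))) && (left_part X \in faces D).

Lemma over_face_sub X Y : over_face X -> Y \subset X -> over_face Y.
Proof.
case/andP => indX leftX YX; rewrite /over_face (faces_sub indX YX) /=.
by apply: faces_sub leftX _; apply: preimsetS.
Qed.

(* Faces with a fixed left part [A] in [D] form a cone with apex any facet
   containing [A]; this kills cocycles one size of [A] at a time. *)
Lemma over_face_acyclic (b : {set W} -> k) :
  (forall X, X \subset U -> over_face X -> cobound e b X = 0) ->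
  exists h, forall X, X \subset U -> over_face X -> b X = cobound e h X.
Proof.
move=> b0.
suff /(_ #|V|.+1)[h bh] N : exists h, forall X, X \subset U -> over_face X ->
    (#|left_part X| < N)%N -> b X = cobound e h X.
  by exists h => X XU oX; apply: bh => //; rewrite ltnS max_card.
elim: N => [|N [h bh]]; first by exists (fun _ => 0).
have [phi phiP] : exists phi : {set V} -> option F, forall A, A \in faces D ->
    exists2 psi, phi A = Some psi & A \subset val psi.
  exists (fun A => [pick psi : F | A \subset val psi]) => A /facet_above[psi Apsi].
  by case: pickP => [psi' |/(_ psi)]; [exists psi' | rewrite Apsi].
pose r X := b X - cobound e h X.
have r0 X : X \subset U -> over_face X -> (#|left_part X| < N)%N -> r X = 0.
  by move=> XU oX ltN; rewrite /r bh ?subrr.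
have dr0 X : X \subset U -> over_face X -> cobound e r X = 0.
  by move=> XU oX; rewrite coboundB b0 // (cobound_cobound _ se) ?subrr.
(* The correction lives on left parts of size exactly [N], so it leaves the equations for smaller
   left parts untouched. *)
pose h1 X := if #|left_part X| == N then
  if phi (left_part X) is Some psi then contract e (inr psi) r X else 0 else 0.
exists (fun X => h X + h1 X) => X XU oX; rewrite ltnS coboundD => leN.
apply/eqP; rewrite addrC -subr_eq -/(r X); apply/eqP.
have oD1 x : over_face (X :\ x) by apply: over_face_sub oX (subsetDl _ _).
have UD1 x : X :\ x \subset U by apply: subset_trans (subsetDl _ _) XU.
have lt_left (v : V) : inl v \in X -> (#|left_part (X :\ inl v)| < #|left_part X|)%N.
  by move=> vX; rewrite left_partD1l [ltnRHS](cardsD1 v) inE vX.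
move: leN; rewrite leq_eqVlt => /orP[/eqP eqN | ltN]; last first.
  rewrite r0 // cobound_eq0 // => x xX; rewrite /h1 ltn_eqF //.
  apply: leq_ltn_trans ltN; apply: subset_leq_card; apply: preimsetS.
  exact: subsetDl.
have [_ leftX] := andP oX; have [psi phiX leq_psi] := phiP _ leftX.
have psiU Y : Y \subset U -> inr psi |: Y \subset U.
  by move=> YU; rewrite subUset sub1set inE.
have psi_face Y : Y \subset X -> over_face (inr psi |: Y).
  move=> YX; have := over_face_sub oX YX.
  rewrite /over_face left_partU1r => /andP[indY ->]; rewrite andbT.
  apply/bip_faceP => v psi'; rewrite !inE /= => vY /orP[/eqP[->] | psiY].
    by apply: (subsetP leq_psi); rewrite inE (subsetP YX).
  by move/bip_faceP: indY; apply.
have psiX : inr psi \in U by rewrite inE.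
(* Removing a point of [V] leads to smaller left parts, where [r] and [h1] vanish; removing a facet
   keeps the left part and so the apex [psi]. *)
rewrite -[LHS](contract_homotopy r se psiX XU) {2}/contract.
rewrite dr0 ?psi_face ?psiU // mulr0 if_same addr0; apply: eq_cobound => -[v|psi'] xX.
  have ltl := lt_left v xX; rewrite /h1 ltn_eqF; last by rewrite -eqN.
  rewrite /contract; case: ifP => // _; rewrite r0 ?mulr0 ?psi_face ?psiU ?subsetDl //.
  by rewrite left_partU1r -eqN.
by rewrite /h1 left_partD1r eqN eqxx phiX.
Qed.

(* [Ind (bip D)] restricted to [U] is the union of the acyclic complex above and
   the full simplex on [S], which meet in the restriction of [D] to [S].  The new
   class is the connecting homomorphism of that Mayer-Vietoris sequence. *)
Lemma suspension_class (s : nat) :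
  S != set0 ->
  nonzero_class k eV (mem (faces D)) S s ->
  nonzero_class k e (mem (faces (Ind (bip D)))) U s.+1.
Proof.
move=> /set0Pn[v0 v0S] [c [cs c0 cN]].
have sV := sign_system_inl.
(* [c] is extended by zero beyond [D]. The coboundary of the extension, placed on the simplex over
   [S], represents the image under the connecting map. *)
pose c' A := if A \in faces D then c A else 0.
pose E X := if inl @: left_part X == X then cobound eV c' (left_part X) else 0.
have E_inl A : E (inl @: A) = cobound eV c' A by rewrite /E left_part_imset eqxx.
have E_inr X phi : inr phi \in X -> E X = 0.
  by rewrite /E; case: eqP => // <-; rewrite (negbTE (imset_inl_disjoint _ _)).
have leftU X : X \subset U -> left_part X \subset S.
  by move=> XU; apply/subsetP => v; rewrite inE => /(subsetP XU); rewrite inE.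
have dc' A : A \subset S -> A \in faces D -> cobound eV c' A = 0.
  move=> AS AD; rewrite -(c0 _ AS AD); apply: eq_cobound => a _.
  by rewrite /c' (faces_sub AD) ?subsetDl.
exists E; split=> [X XU | X XU indX | [b bE]].
- rewrite {1}/E; case: ifP => [/eqP defX|_]; last by rewrite eqxx.
  case/cobound_neq0 => a aX; rewrite /c'; case: ifP => [_|]; last by rewrite eqxx.
  move=> /cs card_s; rewrite -defX card_imset; last by move=> ? ? [].
  rewrite (cardsD1 a) aX card_s //.
  by apply: subset_trans (subsetDl _ _) (leftU _ XU).
- have [/existsP[phi phiX] | noF] := boolP [exists phi : F, inr phi \in X].
    apply: cobound_eq0 => -[v|psi] xX; first by apply: (E_inr _ phi); rewrite !inE.
    rewrite /E; case: ifP => // _; rewrite left_partD1r dc' ?leftU //.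
    exact: left_face phiX.
  have -> : X = inl @: left_part X.
    apply/setP => -[v|phi]; first by rewrite mem_imset_inl inE.
    rewrite (negbTE (imset_inl_disjoint _ _)).
    by apply: contraNF noF => phiX; apply/existsP; exists phi.
  rewrite cobound_imset_inl.
  rewrite -[RHS](cobound_cobound c' sV (leftU _ XU)).
  by apply: eq_cobound => a _; apply: E_inl.
(* If [E] is the coboundary of [b], then [b] is a cocycle on the acyclic piece, where [E] vanishes,
   and so bounds there. *)
have [X XU /andP[indX leftX] | h bh] := over_face_acyclic (b := b).
  rewrite -bE // /E; case: ifP => // _; exact: dc' (leftU _ XU) leftX.
have inl_ind A : inl @: A \in faces (Ind (bip D)).
  by apply/bip_faceP => v phi _; rewrite (negbTE (imset_inl_disjoint _ _)).
(* On the full simplex over [S], [c'] and [b] have the same coboundary, so their difference bounds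
   by contraction to [v0]; adding [h] bounds [c]. *)
pose f A := c' A - b (inl @: A).
have df0 A : A \subset S -> predT A -> cobound eV f A = 0.
  move=> AS _; rewrite coboundB -(cobound_imset_inl e b) -bE ?imset_inl_support //; last exact: inl_ind.
  by rewrite E_inl subrr.
have fE := cone_acyclic sV v0S (fun _ _ _ => isT) df0.
apply: cN; exists (fun A => h (inl @: A) + contract eV v0 f A) => A AS AD.
rewrite coboundD -fE // -(cobound_imset_inl e h) -bh ?imset_inl_support //; last first.
  by rewrite /over_face inl_ind left_part_imset.
by rewrite /f /c' (_ : A \in faces D = true) // addrC subrK.
Qed.

End Sign.

(** A facet misses some [v], since [V] is not a face. Restricted to [v] and this facet, the
    independence complex is two isolated points, and the indicator of one of them is a class. *)
Lemma edge_class :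
  [set: V] \notin faces D -> set0 \in faces D ->
  exists U, forall e, nonzero_class k e (mem (faces (Ind (bip D)))) U 1.
Proof.
move=> DnT /facet_above[phi _].
have [v vphi] : exists v, v \notin val phi.
  apply/existsP; apply: contraR DnT; rewrite negb_exists => /forallP all_in.
  suff <- : val phi = setT by exact: facet_face.
  by apply/setP => v; rewrite inE; have := all_in v; rewrite negbK.
exists [set inl v; inr phi] => e; exists (fun X => (X == [set inl v])%:R); split.
- by move=> X _; case: (X =P [set inl v]) => [-> _|_]; rewrite ?cards1 ?eqxx.
- move=> X XU indX; apply: cobound_eq0 => x xX; case: eqP => // defX.
  have vX : inl v \in X by move: (set11 (inl v : W)); rewrite -defX => /setD1P[].
  have := subsetP XU _ xX; rewrite !inE => /orP[]/eqP defx.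
    by move: (set11 (inl v : W)); rewrite -defX defx setD11.
  by move/bip_faceP: indX => /(_ v phi vX); rewrite -defx xX (negbTE vphi) => /(_ isT).
case=> h hE.
(* Up to sign, a coboundary takes the same value [h set0] at both points, whereas the indicator
   takes 1 and 0. *)
have single x : x \in [set inl v; inr phi] ->
    ([set x] == [set inl v])%:R = (-1) ^+ e x [set x] * h set0 :> k.
  move=> xU; rewrite hE ?sub1set //; last exact: (faces_vertex (Ind (bip D))).
  rewrite /cobound big_set1; congr (_ * h _).
  by apply/setP => y; rewrite !inE; case: eqP.
have h0 : h set0 = 0.
  have := single (inr phi); rewrite set22 (inj_eq set1_inj) => /(_ isT) /esym/eqP.
  by rewrite mulf_eq0 signr_eq0 => /eqP.
have := single (inl v); rewrite set21 eqxx h0 mulr0 => /(_ isT)/eqP.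
by rewrite oner_eq0.
Qed.

End Suspension.

(** * Koszul complexes *)

Section Monomials.
Variable V : finType.
Implicit Types (A T : {set V}) (m a : 'X_{1..#|V|}).

Definition mset T : 'X_{1..#|V|} := [multinom (enum_val i \in T : nat) | i < #|V|].

Definition msetsupp m : {set V} := [set v | m (enum_rank v) != 0%N].

Lemma msetE T v : mset T (enum_rank v) = (v \in T) :> nat.
Proof. by rewrite mnmE enum_rankK. Qed.

Lemma mnm_enum_rankP m1 m2 :
  (forall v, m1 (enum_rank v) = m2 (enum_rank v)) -> m1 = m2.
Proof. by move=> eq12; apply/mnmP => i; rewrite -(enum_valK i). Qed.

Lemma mset_le T m : (mset T <= m)%MM = (T \subset msetsupp m).
Proof.
apply/mnm_lepP/subsetP => [le v vT | sub i].
  by have := le (enum_rank v); rewrite inE msetE vT lt0n.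
rewrite -(enum_valK i) msetE; case: (boolP (_ \in T)) => // /sub.
by rewrite inE lt0n.
Qed.

Lemma mset0 : mset set0 = 0%MM.
Proof. by apply: mnm_enum_rankP => v; rewrite msetE inE mnm0E. Qed.

Lemma msetU1 v T : v \notin T -> mset (v |: T) = (U_(enum_rank v) + mset T)%MM.
Proof.
move=> vT; apply: mnm_enum_rankP => w.
rewrite mnmDE mnm1E !msetE !inE (inj_eq enum_rank_inj) [w == v]eq_sym.
by case: eqVneq => //= <-; rewrite (negbTE vT).
Qed.

Lemma mdeg_mset T : mdeg (mset T) = #|T|.
Proof.
rewrite mdegE (reindex enum_rank) /=; last first.
  by apply: onW_bij; exists enum_val; [apply: enum_rankK | apply: enum_valK].
have -> : #|T| = (\sum_(v in T) 1)%N by rewrite sum1_card.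
by rewrite [RHS]big_mkcond /=; apply: eq_bigr => v _; rewrite msetE; case: (_ \in _).
Qed.

Lemma msetsupp_mset T : msetsupp (mset T) = T.
Proof. by apply/setP => v; rewrite inE msetE; case: (_ \in _). Qed.

Lemma msetsuppD m1 m2 : msetsupp (m1 + m2)%MM = msetsupp m1 :|: msetsupp m2.
Proof. by apply/setP => v; rewrite !inE mnmDE addn_eq0 negb_and. Qed.

Lemma msetB A T : A \subset T -> (mset T - mset (T :\: A))%MM = mset A.
Proof.
move=> /subsetP AT; apply: mnm_enum_rankP => v; rewrite mnmBE !msetE inE.
by have := AT v; case: (v \in A) => [->|]; case: (v \in T).
Qed.

End Monomials.

Section Coefficients.
Variables (k : fieldType) (n : nat).
Implicit Types (p q : {mpoly k[n]}) (m : 'X_{1..n}).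

Lemma mcoeffXM i p m :
  ('X_i * p)@_m = if m i == 0%N then 0 else p@_(m - U_(i)).
Proof.
rewrite -commr_mpolyX; case: ifPn => [/eqP mi0 | mi].
  apply: memN_msupp_eq0; rewrite (perm_mem (msuppMX _ _)).
  by apply/mapP => -[m' _ defm]; move: mi0; rewrite defm mnmDE mnm1E eqxx.
by rewrite -{1}[m](submK (m := U_(i))) ?lep1mP // addmC mcoeffMX.
Qed.

Lemma mcoeff_sign (b : bool) p m : ((-1) ^+ b * p)@_m = (-1) ^+ b * p@_m :> k.
Proof. by rewrite !mulr_sign; case: b; rewrite ?mcoeffN. Qed.

Lemma mpoly_with_coefs (E : 'X_{1..n} -> k) b :
  (forall m, (b <= mdeg m)%N -> E m = 0) -> exists p, forall m, p@_m = E m.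
Proof.
move=> E0; exists (\sum_(m : 'X_{1..n < b}) (E m *: 'X_[m])) => m.
case: (ltnP (mdeg m) b) => [/mcoeff_mpoly-> // | le_bm].
rewrite E0 // raddf_sum big1 //= => m' _; rewrite mcoeffZ mcoeffX.
case: eqP => [defm|]; rewrite ?mulr0 //.
by have := bmdeg m'; rewrite defm ltnNge le_bm.
Qed.

Definition mtrunc (P : pred 'X_{1..n}) p : {mpoly k[n]} :=
  \sum_(m <- msupp p | P m) p@_m *: 'X_[m].

Lemma mcoeff_mtrunc P p m : (mtrunc P p)@_m = if P m then p@_m else 0.
Proof.
rewrite raddf_sum /= big_mkcond /=.
under eq_bigr => m' _ do rewrite mcoeffZ mcoeffX mulr_natr mulrb.
have [mp | mp] := boolP (m \in msupp p).
  rewrite (bigD1_seq m) ?msupp_uniq //= eqxx big1 ?addr0 //.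
  by move=> m' /negbTE->; rewrite if_same.
rewrite (memN_msupp_eq0 mp) if_same big_seq big1 // => m' m'p.
by rewrite ifN_eq ?if_same //; apply: contraNneq mp => <-.
Qed.

Lemma mtruncM (P P' : pred 'X_{1..n}) p q :
  (forall m m', m' \in msupp q -> P (m + m')%MM = P' m) ->
  mtrunc P (p * q) = mtrunc P' p * q.
Proof.
move=> PP'; apply/mpolyP => m; rewrite mcoeff_mtrunc !mcoeffM.
case: ifPn => [Pm | nPm]; last first.
  rewrite big1 // => -[m1 m2] /= /eqP defm; rewrite mcoeff_mtrunc.
  case: ifPn => P'm1; last by rewrite mul0r.
  have [/PP' eqP | /memN_msupp_eq0->] := boolP (bmnm m2 \in msupp q); last exact: mulr0.
  by rewrite defm eqP P'm1 in nPm.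
apply: eq_bigr => -[m1 m2] /= /eqP defm; rewrite mcoeff_mtrunc.
case: ifPn => // nP'm1.
have [/PP' eqP | /memN_msupp_eq0->] := boolP (bmnm m2 \in msupp q); last by rewrite !mulr0.
by rewrite defm eqP (negbTE nP'm1) in Pm.
Qed.

End Coefficients.

Lemma setDD1 (V : finType) (P A : {set V}) t :
  t \in P -> P :\: (A :\ t) = t |: (P :\: A).
Proof. by move=> tP; apply/setP => y; rewrite !inE; case: eqVneq => [->|]. Qed.

Section Koszul.
Variables (k : fieldType) (V : finType) (e : V -> {set V} -> bool).
Local Notation R := {mpoly k[#|V|]}.
Implicit Types (u w : {set V} -> R) (A T P : {set V}) (m a : 'X_{1..#|V|}).

(* [u] stands for the element [\sum_T u T e_T] of the Koszul complex. *)
Definition koszul u T : R :=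
  \sum_(t | t \notin T) (-1) ^+ e t (t |: T) * ('X_(enum_rank t) * u (t |: T)).

Lemma eq_koszul u w T :
  (forall t, t \notin T -> u (t |: T) = w (t |: T)) -> koszul u T = koszul w T.
Proof. by move=> uw; apply: eq_bigr => t tT; rewrite uw. Qed.

Lemma koszulB u w T : koszul (fun A => u A - w A) T = koszul u T - koszul w T.
Proof. by rewrite -sumrB; apply: eq_bigr => t _; rewrite !mulrBr. Qed.

(* Indexing by the complement turns the strand of the Koszul complex in
   multidegree [a] into a simplicial cochain complex on the support of [a]. *)
Definition strand a u A : k :=
  (u (msetsupp a :\: A))@_(a - mset (msetsupp a :\: A)).

Definition dual_sign P t A : bool := e t (t |: (P :\: A)).

Lemma dual_sign_system P : sign_system setT e -> sign_system P (dual_sign P).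
Proof.
move=> se A a b AP aA bA ab; rewrite /dual_sign.
have D1 x y : x \in A -> x != y -> (x |: (y |: (P :\: A))) :\ x = y |: (P :\: A).
  move=> xA xy; apply/setP => z; rewrite !inE.
  by case: (z =P x) => //= ->; rewrite (negbTE xy) xA.
rewrite !setDD1 ?(subsetP AP) // ![b |: (a |: _)]setUCA.
have := se (a |: (b |: (P :\: A))) a b (subsetT _).
rewrite !inE !eqxx !orbT => /(_ isT isT ab).
rewrite D1 // [in e a (_ :\ b)]setUCA D1 // 1?eq_sym //.
by case: (e _ _); case: (e _ _); case: (e _ _); case: (e _ _).
Qed.

(** A variable outside [msetsupp a :\: A] is either in [A] or absent from [a]; in the second case it
    does not divide the monomial and contributes nothing. *)
Lemma mcoeff_koszul a u A : A \subset msetsupp a ->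
  (koszul u (msetsupp a :\: A))@_(a - mset (msetsupp a :\: A)) =
  cobound (dual_sign (msetsupp a)) (strand a u) A.
Proof.
move=> AP; rewrite raddf_sum /= (bigID (mem A)) /= addrC big1 ?add0r; last first.
  move=> t /andP[tPA tA]; rewrite mcoeff_sign mcoeffXM mnmBE msetE.
  move: tPA; rewrite !inE tA /= negbK => /eqP->.
  by rewrite sub0n eqxx mulr0.
apply: eq_big => [t | t /andP[tPA tA]].
  by rewrite !inE; case: (t \in A); rewrite ?andbF.
rewrite mcoeff_sign mcoeffXM mnmBE msetE (negbTE tPA) subn0.
have := subsetP AP t tA; rewrite inE => /negbTE->.
by rewrite /strand setDD1 ?(subsetP AP) // msetU1 // submDA addmC.
Qed.

Lemma koszul_strand u T m (a := (m + mset T)%MM) :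
  (koszul u T)@_m =
  cobound (dual_sign (msetsupp a)) (strand a u) (msetsupp a :\: T).
Proof.
rewrite -mcoeff_koszul ?subsetDl // setDDr setDv set0U.
have /setIidPr-> : T \subset msetsupp a by rewrite msetsuppD msetsupp_mset subsetUr.
by rewrite addmK.
Qed.

Lemma coefs_of_strands (g : 'X_{1..#|V|} -> {set V} -> k) b :
  exists w, forall a A, A \subset msetsupp a ->
    strand a w A = if (mdeg a < b)%N then g a A else 0.
Proof.
have coefs T : exists p : R, forall m, p@_m =
    if (mdeg (m + mset T) < b)%N then g (m + mset T)%MM (msetsupp (m + mset T) :\: T)
    else 0.
  apply: (@mpoly_with_coefs _ _ _ b) => m bm.
  by rewrite ltnNge mdegD (leq_trans bm (leq_addr _ _)).
have [w wE] := functional_choice _ coefs.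
exists w => a A AP; rewrite /strand wE submK ?mset_le ?subsetDl //.
by rewrite setDDr setDv set0U (setIidPr AP).
Qed.

(* The monomials with support in [X] form a basis of the quotient by a
   squarefree monomial ideal, so [vanish X f] says that [f] is in that ideal. *)
Definition vanish (X : pred {set V}) (f : R) := forall m, X (msetsupp m) -> f@_m = 0.

Definition std_face (X : pred {set V}) a A := X (msetsupp (a - mset (msetsupp a :\: A))).

(** Strands do not interact, so bounds [g a] in each multidegree assemble into one element. They are
    kept only below a degree [b] from which on [u] has no coefficients, so that the result is
    polynomial. *)
Lemma boundary_of_strands (X : pred {set V}) u :
  (forall a, exists g, forall A, A \subset msetsupp a -> std_face X a A ->
     strand a u A = cobound (dual_sign (msetsupp a)) g A) ->
  exists w, forall T, vanish X (u T - koszul w T).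
Proof.
move=> /functional_choice[g gE].
pose b := (\max_(T : {set V}) (msize (u T) + #|T|))%N.
have [w wE] := coefs_of_strands g b.
exists w => T m Xm; apply/eqP; rewrite mcoeffB subr_eq0; apply/eqP.
rewrite koszul_strand; set a := (m + mset T)%MM.
have TP : T \subset msetsupp a by rewrite msetsuppD msetsupp_mset subsetUr.
have DD : msetsupp a :\: (msetsupp a :\: T) = T by rewrite setDDr setDv set0U (setIidPr TP).
have -> : (u T)@_m = strand a u (msetsupp a :\: T) by rewrite /strand DD addmK.
case: (ltnP (mdeg a) b) => [ab | ba].
  rewrite gE ?subsetDl //; last by rewrite /std_face DD addmK.
  apply: eq_cobound => t tD; rewrite wE ?ab //.
  exact: subset_trans (subsetDl _ _) (subsetDl _ _).
rewrite cobound_eq0 => [|t tD]; last first.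
  by rewrite wE ?ltnNge ?ba //; exact: subset_trans (subsetDl _ _) (subsetDl _ _).
rewrite /strand DD addmK; apply: memN_msupp_eq0; apply: msize_mdeg_ge.
rewrite -(leq_add2r #|T|) -(mdeg_mset T) -mdegD mdeg_mset (leq_trans _ ba) //.
exact: (leq_bigmax T).
Qed.

Hypothesis se : sign_system setT e.

Lemma koszul_koszul u T : koszul (koszul u) T = 0.
Proof.
apply/mpolyP => m; rewrite koszul_strand mcoeff0; set a := (m + mset T)%MM.
rewrite -(cobound_cobound (strand a u) (dual_sign_system (P := msetsupp a) se) (subsetDl _ T)).
apply: eq_cobound => t _; apply: mcoeff_koszul.
exact: subset_trans (subsetDl _ _) (subsetDl _ _).
Qed.

Lemma strand_cocycle (X : pred {set V}) u a A :
  (forall T, vanish X (koszul u T)) -> A \subset msetsupp a -> std_face X a A ->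
  cobound (dual_sign (msetsupp a)) (strand a u) A = 0.
Proof. by move=> cyc AP XA; rewrite -mcoeff_koszul // cyc. Qed.

(** Over the polynomial ring every strand is a full simplex, hence a cone once its support is
    nonempty. Multidegree 0 is the constant term excluded by hypothesis. *)
Lemma koszul_exact u :
  (forall T, koszul u T = 0) -> (u set0)@_0 = 0 -> exists w, forall T, u T = koszul w T.
Proof.
move=> du0 u00.
have [a | w wE] := @boundary_of_strands predT u; last first.
  by exists w => T; apply/eqP; rewrite -subr_eq0; apply/eqP/mpolyP => m; rewrite wE // mcoeff0.
have [a0 | [v va]] := set_0Vmem (msetsupp a).
  exists (fun _ => 0) => A; rewrite a0 subset0 => /eqP-> _.
  rewrite cobound_eq0 // /strand a0 setD0 mset0 subm0.
  suff -> : a = 0%MM by [].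
  apply: mnm_enum_rankP => v; rewrite mnm0E; apply/eqP.
  by have /setP/(_ v) := a0; rewrite !inE => /negbFE.
exists (contract (dual_sign (msetsupp a)) v (strand a u)).
apply: cone_acyclic (dual_sign_system se) va _ _ => // A AP.
by apply: strand_cocycle => // T m _; rewrite du0 mcoeff0.
Qed.

Lemma std_face_cone (X : pred {set V}) a v A :
  (1 < a (enum_rank v))%N -> std_face X a (v |: A) = std_face X a A.
Proof.
move=> av; congr X; apply/setP => w; rewrite !inE !mnmBE !msetE !inE.
by case: (w =P v) => //= ->; case: (a _) av => [|[|c]] // _; case: (v \in A).
Qed.

(** [p] is the homological degree, [j] the internal degree and [c] the degree of the free generator
    that carries [u]; each [e_t] has degree 1. *)
Definition khomog (p j c : nat) u :=
  forall T m, (u T)@_m != 0 -> #|T| = p /\ (mdeg m + p + c)%N = j.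

(** One direction of Hochster's formula: if no squarefree strand carried a class, all strands would
    bound, and so would [u]. The degrees of [u] confine each such strand to sets of size [j - i]. *)
Lemma koszul_class (X : pred {set V}) u (i j : nat) :
  khomog i j 0 u -> (forall T, vanish X (koszul u T)) ->
  ~ (exists w, forall T, vanish X (u T - koszul w T)) ->
  exists S s, (i + s)%N = j /\ nonzero_class k (dual_sign S) X S s.
Proof.
move=> hu cyc nbd; apply: NNPP => noclass; apply: nbd.
apply: boundary_of_strands => a; set P := msetsupp a.
(* A variable with exponent at least 2 divides every monomial of the strand, so
   the strand is a cone. *)
have [/existsP[v av] | /existsPn sqf] := boolP [exists v, 1 < a (enum_rank v)]%N.
  have vP : v \in P by rewrite inE -lt0n ltnW.
  exists (contract (dual_sign P) v (strand a u)).
  apply: cone_acyclic (dual_sign_system se) vP _ _ => A AP.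
    by rewrite std_face_cone.
  exact: strand_cocycle.
have defa : a = mset P.
  apply: mnm_enum_rankP => v; have := sqf v; rewrite msetE inE.
  by case: (a _) => [|[]].
have faceE A : A \subset P -> std_face X a A = X A.
  by move=> AP; rewrite /std_face -/P {1}defa msetB // msetsupp_mset.
have hA A : A \subset P -> strand a u A != 0 -> (i + #|A|)%N = j.
  by move=> AP /hu[_ <-]; rewrite -/P {1}defa msetB // mdeg_mset addn0 addnC.
have [/exists_inP[A0 A0P nz0] | ] := boolP [exists (A : {set V} | A \subset P), strand a u A != 0];
    last first.
  rewrite negb_exists_in => /forall_inP z; exists (fun _ => 0) => A AP _.
  by rewrite cobound_eq0 //; apply/eqP; have := z A AP; rewrite negbK.
apply: NNPP => nbd; apply: noclass; exists P, #|A0|; split; first exact: hA.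
exists (strand a u); split=> [A AP nzA | A AP XA | [h hE]].
- by apply/eqP; rewrite -(eqn_add2l i) (hA _ AP nzA) (hA _ A0P nz0).
- by apply: (strand_cocycle cyc AP); rewrite faceE.
- by apply: nbd; exists h => A AP; rewrite faceE // => XA; apply: hE.
Qed.

(** The other direction: the class is placed in the single multidegree [mset S], so the homological
    degree is [#|S| - s] and the internal degree [#|S|]. *)
Lemma class_koszul (X : pred {set V}) S s :
  nonzero_class k (dual_sign S) X S s ->
  exists i u, [/\ (i + s)%N = #|S|, khomog i #|S| 0 u,
    forall T, vanish X (koszul u T) & ~ exists w, forall T, vanish X (u T - koszul w T)].
Proof.
case=> c [cs c0 cN].
have [A0 A0S nz0] : exists2 A : {set V}, A \subset S & c A != 0.
  apply: NNPP => nz; apply: cN; exists (fun _ => 0) => A AS _.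
  rewrite cobound_eq0 //; apply/eqP; apply: contraT => nzA; case: nz; by exists A.
have leS : (s <= #|S|)%N by rewrite -(cs _ A0S nz0) subset_leq_card.
have cardD A : A \subset S -> #|A| = s -> #|S :\: A| = (#|S| - s)%N.
  by move=> AS <-; rewrite cardsD (setIidPr AS).
pose u T : R := if T \subset S then c (S :\: T) *: 'X_[mset (S :\: T)] else 0.
have uE T m : (u T)@_m != 0 -> [/\ T \subset S, m = mset (S :\: T) & c (S :\: T) != 0].
  rewrite /u; case: ifPn => [TS|_]; last by rewrite mcoeff0 eqxx.
  by rewrite mcoeffZ mcoeffX mulf_eq0 negb_or; case: (_ =P m) => [<- /andP[]|_]; rewrite ?eqxx ?andbF.
have DD A : A \subset S -> S :\: (S :\: A) = A.
  by move=> AS; rewrite setDDr setDv set0U (setIidPr AS).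
have strandE A : A \subset S -> strand (mset S) u A = c A.
  move=> AS; rewrite /strand msetsupp_mset /u subsetDl DD // msetB //.
  by rewrite mcoeffZ mcoeffX eqxx mulr1.
exists (#|S| - s)%N, u; split; first by rewrite subnK.
- move=> T m /uE[TS -> /cs cardDT]; rewrite mdeg_mset cardDT ?subsetDl // addn0 subnKC //.
  by split=> //; rewrite -(DD T TS) cardD ?subsetDl // cardDT ?subsetDl.
- move=> T m Xm; rewrite koszul_strand; set a := (m + mset T)%MM.
  have TP : T \subset msetsupp a by rewrite msetsuppD msetsupp_mset subsetUr.
  have [defa | neqa] := eqVneq a (mset S).
    have defm : m = mset (S :\: T).
      rewrite -(addmK (mset T) m) -/a defa -{1}(DD T) ?msetB ?subsetDl //.
      by rewrite -(msetsupp_mset S) -defa.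
    rewrite defa msetsupp_mset -[RHS](c0 (S :\: T)) ?subsetDl //; last first.
      by move: Xm; rewrite defm msetsupp_mset.
    apply: eq_cobound => t _; apply: strandE.
    exact: subset_trans (subsetDl _ _) (subsetDl _ _).
  apply: cobound_eq0 => t _; apply/eqP; apply: contraNT neqa => /uE[TS eqm _].
  set T' := _ :\: _ in TS eqm; have le : (mset T' <= a)%MM by rewrite mset_le subsetDl.
  rewrite -[X in X == _](submK le) eqm -(msetB (subsetDl S T')) DD // submK //.
  by rewrite mset_le msetsupp_mset.
case=> w wE; apply: cN; exists (strand (mset S) w) => A AS XA.
have := @mcoeff_koszul (mset S) w A; rewrite msetsupp_mset => /(_ AS) <-.
have := wE (S :\: A) (mset A); rewrite msetsupp_mset => /(_ XA)/eqP.
rewrite mcoeffB subr_eq0 msetB // => /eqP <-.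
by rewrite -(strandE A AS) /strand msetsupp_mset msetB.
Qed.

End Koszul.

(** * Koszul complexes with coefficients in graded free modules *)

Section KoszulRows.
Variables (k : fieldType) (V : finType) (e : V -> {set V} -> bool).
Local Notation R := {mpoly k[#|V|]}.
Implicit Types (A T : {set V}).
Hypothesis se : sign_system setT e.

Definition koszul_row n (z : {set V} -> 'rV[R]_n) T : 'rV[R]_n :=
  \row_r koszul e (fun A => z A 0 r) T.

Lemma eq_koszul_row n (z w : {set V} -> 'rV[R]_n) T :
  (forall t, t \notin T -> z (t |: T) = w (t |: T)) -> koszul_row z T = koszul_row w T.
Proof.
by move=> zw; apply/rowP => r; rewrite !mxE; apply: eq_koszul => t /zw->.
Qed.

Lemma koszul_rowB n (z w : {set V} -> 'rV[R]_n) T :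
  koszul_row (fun A => z A - w A) T = koszul_row z T - koszul_row w T.
Proof.
apply/rowP => r; rewrite !mxE -koszulB; apply: eq_koszul => t _.
by rewrite !mxE.
Qed.

Lemma koszul_row0 n T : koszul_row (fun _ => 0 : 'rV[R]_n) T = 0.
Proof. by apply/rowP => r; rewrite !mxE /koszul big1 // => t _; rewrite !mulr0. Qed.

Lemma koszul_row_mulmx m n (z : {set V} -> 'rV[R]_m) (D : 'M[R]_(m, n)) T :
  koszul_row (fun A => z A *m D) T = koszul_row z T *m D.
Proof.
apply/rowP => q; rewrite !mxE /koszul.
under [RHS]eq_bigr => r _ do rewrite mxE /koszul mulr_suml.
rewrite exchange_big /=; apply: eq_bigr => t _.
by rewrite mxE !mulr_sumr; apply: eq_bigr => r _; rewrite !mulrA.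
Qed.

Lemma koszul_row_koszul_row n (z : {set V} -> 'rV[R]_n) T :
  koszul_row (koszul_row z) T = 0.
Proof.
apply/rowP => r; rewrite !mxE -[RHS](koszul_koszul se (fun A => z A 0 r) T).
by apply: eq_koszul => t _; rewrite mxE.
Qed.

Lemma mcoeff0_koszul_row n (z : {set V} -> 'rV[R]_n) T r : (koszul_row z T 0 r)@_0 = 0.
Proof.
rewrite mxE /koszul raddf_sum big1 //= => t _.
by rewrite mcoeff_sign mcoeffXM mnm0E eqxx mulr0.
Qed.

Lemma koszul_row_exact n (z : {set V} -> 'rV[R]_n) :
  (forall T, koszul_row z T = 0) -> (forall r, (z set0 0 r)@_0 = 0) ->
  exists w, forall T, z T = koszul_row w T.
Proof.
move=> dz0 z00.
have exact_at r : exists w, forall T, z T 0 r = koszul e w T.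
  by apply: koszul_exact => // T; have /rowP/(_ r) := dz0 T; rewrite !mxE.
have [w wE] := functional_choice _ exact_at.
exists (fun T => \row_r w r T) => T; apply/rowP => r; rewrite mxE wE.
by apply: eq_koszul => t _; rewrite mxE.
Qed.

Definition row_homog p j n (g : 'I_n -> nat) (z : {set V} -> 'rV[R]_n) :=
  forall r, khomog p j (g r) (fun T => z T 0 r).

(** The projection commutes with the Koszul differential, up to the shift of [p], and with
    homogeneous matrices, so that lifts can be made homogeneous. *)
Definition row_proj p j n (g : 'I_n -> nat) (z : {set V} -> 'rV[R]_n) T : 'rV[R]_n :=
  \row_r if #|T| == p then mtrunc (fun m => mdeg m + p + g r == j)%N (z T 0 r) else 0.

Lemma mcoeff_row_proj p j n (g : 'I_n -> nat) z T r m :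
  (row_proj p j g z T 0 r)@_m =
  if (#|T| == p) && (mdeg m + p + g r == j)%N then (z T 0 r)@_m else 0.
Proof. by rewrite mxE; case: ifP => _; rewrite ?mcoeff_mtrunc ?mcoeff0. Qed.

Lemma row_proj_homog p j n (g : 'I_n -> nat) z : row_homog p j g (row_proj p j g z).
Proof.
by move=> r T m; rewrite mcoeff_row_proj; case: ifP => [/andP[/eqP-> /eqP->]|]; rewrite ?eqxx.
Qed.

Lemma row_proj_id p j n (g : 'I_n -> nat) z T :
  row_homog p j g z -> row_proj p j g z T = z T.
Proof.
move=> hz; apply/rowP => r; apply/mpolyP => m; rewrite mcoeff_row_proj.
have [-> | /hz[-> ->]] := eqVneq (z T 0 r)@_m 0; by rewrite ?if_same ?eqxx.
Qed.

Lemma eq_row_homog p j n (g : 'I_n -> nat) z w :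
  (forall T, z T = w T) -> row_homog p j g w -> row_homog p j g z.
Proof. by move=> zw hw r T m; rewrite zw; apply: hw. Qed.

Definition mx_homog m n (g' : 'I_m -> nat) (g : 'I_n -> nat) (D : 'M[R]_(m, n)) :=
  forall p q, {in msupp (D p q), forall m, (mdeg m + g q = g' p)%N}.

Lemma row_proj_mulmx p j m n (g' : 'I_m -> nat) (g : 'I_n -> nat) D z T :
  mx_homog g' g D ->
  row_proj p j g (fun A => z A *m D) T = row_proj p j g' z T *m D.
Proof.
move=> hD; apply/rowP => q; rewrite !mxE.
under [RHS]eq_bigr => r _ do rewrite mxE.
case: eqP => _; last by rewrite big1 // => r _; rewrite mul0r.
rewrite (_ : mtrunc _ _ = \sum_r mtrunc (fun a => mdeg a + p + g q == j)%N (z T 0 r * D r q)).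
  apply: eq_bigr => r _; apply: mtruncM => a b /hD <-.
  by rewrite mdegD [(_ + _ + p)%N]addnAC addnA.
apply/mpolyP => a; rewrite mcoeff_mtrunc !raddf_sum /=.
by case: ifP => Pa; [|rewrite big1 //]; [apply: eq_bigr|] => r _; rewrite mcoeff_mtrunc Pa.
Qed.

Lemma row_proj_koszul p j n (g : 'I_n -> nat) z T :
  row_proj p j g (koszul_row z) T = koszul_row (row_proj p.+1 j g z) T.
Proof.
apply/rowP => r; apply/mpolyP => m; rewrite mcoeff_row_proj !mxE /koszul.
rewrite !raddf_sum /= -mulrb -sumrMnl; apply: eq_bigr => t tT.
rewrite mulrb !mcoeff_sign !mcoeffXM; have [_ | mt] := eqVneq (m (enum_rank t)) 0%N; first by rewrite !mulr0 if_same.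
rewrite mcoeff_row_proj cardsU1 tT add1n eqSS.
have <- : (mdeg m + p = mdeg (m - U_(enum_rank t)) + p.+1)%N.
  by rewrite addnS -addSn -{1}(submK (m := U_(enum_rank t)) (m' := m)) ?lep1mP // mdegD mdeg1 addn1.
by case: ifP; rewrite ?mulr0.
Qed.

Lemma row_homog_mulmx p j m n (g' : 'I_m -> nat) (g : 'I_n -> nat) D z :
  mx_homog g' g D -> row_homog p j g' z -> row_homog p j g (fun T => z T *m D).
Proof.
move=> hD hz; apply: eq_row_homog (row_proj_homog (g := g) (z := fun T => z T *m D)) => T.
by rewrite (row_proj_mulmx _ _ _ _ hD) row_proj_id.
Qed.

Lemma row_homog_koszul p j n (g : 'I_n -> nat) z :
  row_homog p.+1 j g z -> row_homog p j g (koszul_row z).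
Proof.
move=> hz; apply: eq_row_homog (row_proj_homog (g := g) (z := koszul_row z)) => T.
by rewrite row_proj_koszul; apply: eq_koszul_row => t _; rewrite row_proj_id.
Qed.

End KoszulRows.

(** * Comparison with the resolution *)

Section Resolution.
Variables (k : fieldType) (V : finType) (e : V -> {set V} -> bool).
Local Notation R := {mpoly k[#|V|]}.
Hypothesis se : sign_system setT e.
Variables (X : pred {set V}) (I : R -> Prop) (F : graded_free_resolution I).
Hypothesis Xsub : forall A B : {set V}, X A -> B \subset A -> X B.
Hypothesis IE : forall f, I f <-> vanish X f.
Implicit Types (A T : {set V}) (u : {set V} -> R).
Local Notation gd q := (@gdeg _ _ _ F q).
Local Notation d q := (diff F q).
Local Notation koszul_row := (koszul_row e).

(* A nonzero class of internal degree [j] in [H_p (K (coker (d q)))], where [K]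
   is the Koszul complex; equivalently, [Tor_(p + q) (R/I, k)_j <> 0]. *)
Definition tor (p q j : nat) := exists z : {set V} -> 'rV[R]_(rk F q),
  [/\ row_homog p j (gd q) z,
      exists y, forall T, koszul_row z T = y T *m d q &
      ~ exists w y, forall T, z T = koszul_row w T + y T *m d q].

Lemma diff_diff q (v : 'rV_(rk F q.+2)) : v *m d q.+1 *m d q = 0.
Proof. by apply/diff_exact; exists v. Qed.

Lemma diff_exact_family q (z : {set V} -> 'rV[R]_(rk F q.+1)) :
  (forall T, z T *m d q = 0) -> exists y, forall T, z T = y T *m d q.+1.
Proof. move=> z0; apply: (functional_choice (fun T v => z T = v *m d q.+1)) => T.
by apply/diff_exact. Qed.

(* [z |-> z'] is the connecting map of
   0 -> coker (d q.+1) -> F_q -> coker (d q) -> 0. *)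
Lemma tor_shift_nonzero p q j z (z' : {set V} -> 'rV[R]_(rk F q.+1)) :
  row_homog p.+1 j (gd q) z ->
  (forall T, koszul_row z T = z' T *m d q) ->
  (exists w y, forall T, z T = koszul_row w T + y T *m d q) <->
  (exists w y, forall T, z' T = koszul_row w T + y T *m d q.+1).
Proof.
move=> hz dz; split=> [[w [y zE]] | [w [y z'E]]].
  have /diff_exact_family[y' y'E] T : (z' T - koszul_row y T) *m d q = 0.
    rewrite mulmxBl -dz -koszul_row_mulmx; apply/eqP; rewrite subr_eq0; apply/eqP.
    rewrite (eq_koszul_row e (w := fun A => koszul_row w A + y A *m d q)); last by move=> t _.
    apply/eqP; rewrite -subr_eq0 -koszul_rowB; apply/eqP.
    rewrite -[RHS](koszul_row_koszul_row se w T); apply: eq_koszul_row => t _.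
    by rewrite addrK.
  by exists y, y' => T; rewrite -y'E addrC subrK.
(* The Koszul differential never reads the value at [set0]. Clearing it keeps the boundary and, as
   [z] is zero at [set0], ensures the constant-term condition of exactness. *)
pose w0 T := if T == set0 then 0 else w T.
have [T | r | w' w'E] := @koszul_row_exact _ _ _ se _ (fun T => z T - w0 T *m d q).
- rewrite koszul_rowB koszul_row_mulmx dz z'E mulmxDl diff_diff addr0.
  rewrite (eq_koszul_row e (z := w0) (w := w)) ?subrr // => t _; rewrite /w0.
  by case: eqP => // /setP/(_ t); rewrite !inE eqxx.
- rewrite /w0 eqxx mul0mx subr0; apply/eqP; apply: contraT => /hz[].
  by rewrite cards0.
by exists w', w0 => T; rewrite -w'E subrK.
Qed.

(** The preimage [y] is cut down to its homogeneous part. This is a cycle modulo [d q.+1] because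
    [d q] kills its Koszul boundary. *)
Lemma tor_shift_up p q j : tor p.+1 q j -> tor p q.+1 j.
Proof.
case=> z [hz [y dz] nbd].
pose z' := row_proj p j (gd q.+1) y.
have hd : mx_homog (gd q.+1) (gd q) (d q) by move=> r s m; apply: diff_homog.
have dz' T : koszul_row z T = z' T *m d q.
  rewrite -(row_proj_mulmx _ _ _ _ hd) -(row_proj_id T (row_homog_koszul hz)).
  by apply/rowP => r; rewrite [LHS]mxE [RHS]mxE dz.
exists z'; split; first exact: row_proj_homog.
  apply: diff_exact_family => T; rewrite -koszul_row_mulmx.
  rewrite -[RHS](koszul_row_koszul_row se z T); apply: eq_koszul_row => t _.
  by rewrite dz'.
by move=> bd; apply: nbd; apply/(tor_shift_nonzero hz dz').
Qed.

(** Exactness of the Koszul complex on [F_q] inverts the connecting map. The only obstruction is the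
    constant term at [set0], which minimality makes zero. *)
Lemma tor_shift_down p q j : minimal_resolution F -> tor p q.+1 j -> tor p.+1 q j.
Proof.
move=> minF [z' [hz' [y dz'] nbd]].
have hd : mx_homog (gd q.+1) (gd q) (d q) by move=> r s m; apply: diff_homog.
have [T | r | w wE] := @koszul_row_exact _ _ _ se _ (fun T => z' T *m d q).
- by rewrite koszul_row_mulmx dz' diff_diff.
- rewrite mxE raddf_sum big1 //= => s _.
  by rewrite rmorphM /= minF mulr0.
pose z := row_proj p.+1 j (gd q) w.
have dz T : koszul_row z T = z' T *m d q.
  rewrite -row_proj_koszul -(row_proj_id T (row_homog_mulmx hd hz')).
  by apply/rowP => r; rewrite [LHS]mxE [RHS]mxE -wE.
have hz : row_homog p.+1 j (gd q) z by apply: row_proj_homog.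
by exists z; split=> //; [exists z' | move/(tor_shift_nonzero hz dz)].
Qed.

(** In homological degree 0 a nonzero constant term needs a basis vector of degree [j]. Without one,
    Koszul exactness makes the class a boundary. *)
Lemma tor_top i j : tor 0 i j -> betti F i j != 0%N.
Proof.
case=> z [hz _ nbd]; apply/eqP => b0; apply: nbd.
have [T | r | w wE] := @koszul_row_exact _ _ _ se _ z.
- rewrite -[RHS](@koszul_row0 k V e _ T); apply: eq_koszul_row => t _.
  apply/rowP => r; rewrite mxE; apply/mpolyP => m; rewrite mcoeff0; apply/eqP.
  apply: contraT => /hz[] /eqP; rewrite cards_eq0 => /eqP/setP/(_ t).
  by rewrite !inE eqxx.
- apply/eqP; apply: contraT => /hz[_]; rewrite mdeg0 !add0n => degr.
  have /card0_eq/(_ r) := b0.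
  by rewrite inE degr eqxx.
by exists w, (fun _ => 0) => T; rewrite mul0mx addr0.
Qed.

(** A basis vector of degree [j] gives the class: its constant term is 1, while Koszul boundaries
    and, by minimality, images of [d i] have constant term 0. *)
Lemma betti_tor i j : minimal_resolution F -> betti F i j != 0%N -> tor 0 i j.
Proof.
move=> minF; rewrite -lt0n => /card_gt0P[r]; rewrite inE => /eqP degr.
exists (fun T => if T == set0 then delta_mx 0 r else 0); split.
- move=> s T m; case: (T =P set0) => [->|_]; last by rewrite mxE mcoeff0 eqxx.
  rewrite mxE eqxx /=; case: (s =P r) => [->|_]; last by rewrite mcoeff0 eqxx.
  by rewrite mcoeff1 cards0; case: (m =P 0%MM) => [->|_]; rewrite ?eqxx // mdeg0.
- exists (fun _ => 0) => T; rewrite mul0mx -[RHS](@koszul_row0 k V e _ T).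
  apply: eq_koszul_row => t _; case: eqP => // /setP/(_ t).
  by rewrite !inE eqxx.
case=> w [y /(_ set0)]; rewrite eqxx => /rowP/(_ r)/(congr1 (mcoeff 0%MM)).
rewrite mxE !eqxx [in RHS]mxE mcoeffD mcoeff1 eqxx mcoeff0_koszul_row add0r.
rewrite mxE raddf_sum big1 //= => [/eqP | s _]; first by rewrite oner_eq0.
by rewrite rmorphM /= minF mulr0.
Qed.

Lemma tor_iter_up p q j : tor p q j -> tor 0 (p + q) j.
Proof. by elim: p q => [|p IHp] q // /tor_shift_up/IHp; rewrite addSnnS. Qed.

Lemma tor_iter_down p q j : minimal_resolution F -> tor 0 (p + q) j -> tor p q j.
Proof.
move=> minF; elim: p q => [|p IHp] q //; rewrite addSnnS => /IHp.
exact: tor_shift_down.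
Qed.

Lemma vanishD (f g : R) : vanish X f -> vanish X g -> vanish X (f + g).
Proof. by move=> f0 g0 m Xm; rewrite mcoeffD f0 ?g0 ?addr0. Qed.

Lemma vanishN (f : R) : vanish X f -> vanish X (- f).
Proof. by move=> f0 m Xm; rewrite mcoeffN f0 ?oppr0. Qed.

(** A monomial with support in [X] keeps this property after division by a variable, as [X] is
    closed under subsets. *)
Lemma vanish_koszul u : (forall T, vanish X (u T)) -> forall T, vanish X (koszul e u T).
Proof.
move=> u0 T m Xm; rewrite raddf_sum big1 //= => t _.
rewrite mcoeff_sign mcoeffXM; case: eqP => _; rewrite ?mulr0 // u0 ?mulr0 //.
apply: Xsub Xm _; apply/subsetP => v; rewrite !inE mnmBE.
by apply: contraNneq => ->; rewrite sub0n.
Qed.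

Lemma aug_koszul n (z : {set V} -> 'rV[R]_n) (D : 'cV[R]_n) T :
  (koszul_row z T *m D) 0 0 = koszul e (fun A => (z A *m D) 0 0) T.
Proof. by rewrite -koszul_row_mulmx mxE. Qed.

(** Since [aug] identifies the cokernel of [d 0] with R/I, [u] is lifted through [aug] and the lift
    is projected to the right degrees. *)
Lemma koszul_tor i j u :
  khomog i j 0 u -> (forall T, vanish X (koszul e u T)) ->
  ~ (exists w, forall T, vanish X (u T - koszul e w T)) -> tor i 0 j.
Proof.
move=> hu cyc nbd.
have [y yE] := functional_choice _ (fun T => aug_surj F (u T)).
pose z := row_proj i j (gd 0) y.
have hd : mx_homog (gd 0) (fun _ => 0%N) (aug F).
  by move=> r s m; rewrite addn0 [s]ord1; apply: aug_homog.
have zE T : vanish X (u T - (z T *m aug F) 0 0).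
  move=> m Xm; rewrite mcoeffB -(row_proj_mulmx _ _ _ _ hd) mcoeff_row_proj addn0.
  case: ifPn => [_ | nij]; first by rewrite -mcoeffB; move: m Xm; apply/IE.
  rewrite subr0; apply/eqP; apply: contraNT nij => /hu[->].
  by rewrite addn0 eqxx => ->; rewrite eqxx.
exists z; split; first exact: row_proj_homog.
  apply: (functional_choice (fun T v => koszul_row z T = v *m d 0)) => T.
  apply/aug_exact/IE; rewrite aug_koszul.
  have -> : koszul e (fun A => (z A *m aug F) 0 0) T =
      koszul e u T - koszul e (fun A => u A - (z A *m aug F) 0 0) T.
    by rewrite koszulB opprB addrC subrK.
  by apply: vanishD => //; apply: vanishN; apply: vanish_koszul.
case=> w [v zE']; apply: nbd; exists (fun T => (w T *m aug F) 0 0) => T.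
rewrite -aug_koszul -[u T](subrK ((z T *m aug F) 0 0)) -addrA.
apply: vanishD => //; rewrite zE' mulmxDl mxE addrAC subrr add0r.
by apply/IE/aug_exact; exists (v T).
Qed.

Lemma tor_koszul i j : tor i 0 j -> exists u,
  [/\ khomog i j 0 u, forall T, vanish X (koszul e u T) &
      ~ exists w, forall T, vanish X (u T - koszul e w T)].
Proof.
case=> z [hz [y dz] nbd]; exists (fun T => (z T *m aug F) 0 0).
have hd : mx_homog (gd 0) (fun _ => 0%N) (aug F).
  by move=> r s m; rewrite addn0 [s]ord1; apply: aug_homog.
split; first exact: (row_homog_mulmx hd hz).
  by move=> T; rewrite -aug_koszul; apply/IE/aug_exact; exists (y T); rewrite dz.
case=> w wE; have [x xE] := functional_choice _ (fun T => aug_surj F (w T)).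
apply: nbd; exists x.
apply: (functional_choice (fun T v => z T = koszul_row x T + v *m d 0)) => T.
have [v vE] : exists v, z T - koszul_row x T = v *m d 0; last first.
  by exists v; rewrite -vE addrC subrK.
apply/aug_exact/IE; rewrite mulmxBl mxE [X in _ + X]mxE aug_koszul.
rewrite -[(z T *m _) 0 0](subrK (koszul e w T)) -addrA.
apply: vanishD => //; rewrite -koszulB.
by apply: vanish_koszul => A; apply/IE.
Qed.

Lemma betti_class i j : minimal_resolution F -> betti F i j != 0%N ->
  exists S s, (i + s)%N = j /\ nonzero_class k (dual_sign e S) X S s.
Proof.
move=> minF /(betti_tor minF); rewrite -[i in tor 0 i]addn0.
case/(tor_iter_down minF)/tor_koszul => u [hu cyc nbd].
exact: koszul_class hu cyc nbd.
Qed.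

Lemma class_betti S s : nonzero_class k (dual_sign e S) X S s ->
  exists i j, (i + s)%N = j /\ betti F i j != 0%N.
Proof.
case/class_koszul => i [u [eS hu cyc nbd]]; exists i, #|S|; split=> //.
by apply: tor_top; rewrite -[i]addn0; apply/tor_iter_up/(koszul_tor hu).
Qed.

End Resolution.

(** * The Stanley-Reisner ideal in terms of supports of monomials *)

Section StanleyReisnerIdeal.
Variables (k : fieldType) (V : finType) (D : complex V).

Lemma sqfree_monomialE (N : {set V}) : sqfree_monomial k N = 'X_[mset N].
Proof.
have -> : mset N = (\sum_(v in N) U_(enum_rank v))%MM.
  apply: mnm_enum_rankP => w; rewrite msetE mnm_sumE.
  under eq_bigr => v _ do rewrite mnm1E (inj_eq enum_rank_inj).
  have [wN | wN] := boolP (w \in N); last first.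
    by rewrite big1 // => v vN; case: eqP => // vw; rewrite -vw vN in wN.
  by rewrite (bigD1 w) //= eqxx big1 // => v /andP[_ /negbTE->].
by rewrite /sqfree_monomial mprodXE.
Qed.

Lemma min_nonface_below (A : {set V}) : A \notin faces D ->
  exists2 N, N \in min_nonfaces D & N \subset A.
Proof.
move=> AD; have [N minN NA] := minset_exists (P := [pred A | A \notin faces D]) AD.
by exists N; rewrite // inE.
Qed.

(** A generator divides a monomial exactly when its minimal nonface lies in the support. Conversely,
    each monomial of [f] is assigned to one minimal nonface [nf] inside its support. *)
Lemma SR_ideal_vanish f : SR_ideal D f <-> @vanish k V (mem (faces D)) f.
Proof.
split=> [[c ->] m mD | f0].
  rewrite raddf_sum big1 //= => N; rewrite inE => /minsetp ND.
  apply: memN_msupp_eq0; rewrite sqfree_monomialE (perm_mem (msuppMX _ _)).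
  apply/mapP => -[m' _ defm]; move: mD; rewrite defm msetsuppD msetsupp_mset /= => mD.
  by move: ND; rewrite inE /= (faces_sub mD) ?subsetUl.
have [nf nfP] : exists nf : {set V} -> {set V}, forall A, A \notin faces D ->
    nf A \in min_nonfaces D /\ nf A \subset A.
  apply: (functional_choice (fun A N => A \notin faces D ->
    N \in min_nonfaces D /\ N \subset A)) => A.
  have [AD | /min_nonface_below[N]] := boolP (A \in faces D); first by exists A.
  by exists N.
have nonface m : m \in msupp f -> msetsupp m \notin faces D.
  by rewrite mcoeff_msupp; apply: contraNN => mD; rewrite f0.
(* Membership in [msupp f] is repeated in the condition to match the sum after regrouping by
   [nf]. *)
exists (fun N => \sum_(m <- msupp f | (m \in msupp f) && (nf (msetsupp m) == N))
  f@_m *: 'X_[m - mset N]).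
rewrite {1}[f]mpolyE big_seq_cond.
under eq_bigl => m do rewrite andbT.
rewrite (partition_big (fun m => nf (msetsupp m)) (mem (min_nonfaces D))) /=; last first.
  by move=> m /nonface/nfP[].
apply: eq_bigr => N _; rewrite mulr_suml; apply: eq_bigr => m /andP[/nonface/nfP[_ sub] /eqP defN].
by rewrite sqfree_monomialE -scalerAl -mpolyXD submK // mset_le -defN.
Qed.

End StanleyReisnerIdeal.

(** * The empty vertex set, compatible signs and the conclusion *)

Lemma nonzero_class_set0 (k : fieldType) (V : finType) e (X : pred {set V}) s :
  nonzero_class k e X set0 s -> s = 0%N /\ X set0.
Proof.
case=> c [cs _ cN]; have [X0 | nX0] := boolP (X set0); last first.
  by case: cN; exists c => A; rewrite subset0 => /eqP->; rewrite (negbTE nX0).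
split=> //; have [c0 | nz] := eqVneq (c set0) 0; last by rewrite -(cs _ _ nz) ?cards0.
case: cN; exists c => A; rewrite subset0 => /eqP-> _.
by rewrite c0 /cobound big_set0.
Qed.

Section InducedSign.
Variables (V : finType) (D : complex V).
Variable e : bip_vertex D -> {set bip_vertex D} -> bool.
Local Notation W := (bip_vertex D).

(* Normalized so that taking dual signs commutes with restriction along [inl]. *)
Definition induced_sign (v : V) (A : {set V}) : bool :=
  e (inl v) (inl @: A :|: [set x : W | if x is inr _ then true else false]).

Lemma induced_sign_system : sign_system setT e -> sign_system setT induced_sign.
Proof.
move=> se A a b _ aA bA ab.
set Fs := [set x : W | if x is inr _ then true else false].
have D1 v : (inl @: A :|: Fs) :\ inl v = inl @: (A :\ v) :|: Fs.
  by rewrite -imset_inlD1; apply/setP => -[w|phi]; rewrite !inE ?orbF ?orbT.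
by rewrite /induced_sign -/Fs -!D1; apply: se; rewrite ?subsetT // inE mem_imset_inl ?aA ?bA.
Qed.

Lemma dual_induced_sign (S A : {set V}) v : A \subset S -> v \in A ->
  dual_sign induced_sign S v A =
  dual_sign e (bip_support D S) (inl v) (inl @: A).
Proof.
move=> AS vA; rewrite /dual_sign /induced_sign; congr e; apply/setP => -[w|phi].
  by rewrite !inE mem_imset_inl !inE mem_imset_inl orbF.
by rewrite !inE !(negbTE (imset_inl_disjoint _ _)).
Qed.

End InducedSign.

(* For the full simplex both regularities are 0 and the inequality fails. *)
Theorem theorem3p5 (k : fieldType) (V : finType) (D : complex V)
    (D_not_simplex : [set: V] \notin faces D) (r r' : int)
    (reg_D : is_reg k D r) (reg_BD : is_reg_graph k (bip D) r') :
  r' >= r + 1.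
Proof.
have [F [minF [i [j [nz_ij ->]]] _]] := reg_D; have [G [_ _ le_r']] := reg_BD.
have se : sign_system setT (@rank_sign (bip_vertex D)) := @rank_sign_system _ _.
have face_sub (T : finType) (C : complex T) (A B : {set T}) :
    mem (faces C) A -> B \subset A -> mem (faces C) B := @faces_sub _ C A B.
have [S [s [<- cl]]] := betti_class (induced_sign_system se) (face_sub _ D)
  (SR_ideal_vanish D) minF nz_ij.
have [U clU] : exists U, nonzero_class k (dual_sign (@rank_sign _) U)
    (mem (faces (Ind (bip D)))) U s.+1.
  (* For empty [S] the simplex over [S] has no point to contract to, and an edge of the graph gives
     the class instead. *)
  have [S0 | S0] := eqVneq S set0.
    move: cl; rewrite S0 => /nonzero_class_set0[-> D0].
    have [U clU] := edge_class k D_not_simplex D0.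
    by exists U; apply: clU.
  exists (bip_support D S); apply: suspension_class S0 _; first exact: dual_sign_system.
  apply: eq_nonzero_class cl => v A; exact: dual_induced_sign.
have [i' [j' [<- nz_ij']]] := class_betti se G (face_sub _ _) (SR_ideal_vanish _) clU.
have subDl (a b : nat) : (a + b)%:Z - a%:Z = b%:Z by rewrite PoszD addrC addKr.
by have := le_r' _ _ nz_ij'; rewrite !subDl -[s.+1]addn1 PoszD.
Qed.
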